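(* Let $k\ge2$ be an even integer. For every constant $\epsilon>0$, no randomized online algorithm is $(1-\frac{2}{k+2}+\epsilon)$-competitive against an adaptive online adversary for the maximum-cardinality online matching problem under edge arrivals with a hard budget of $k$ reassignments per arrival. That is, for every randomized online algorithm for this problem and every constant $c\ge0$, there is an adaptive online adversary such that $\mathbb{E}[\mathsf{ALG}]<(1-\frac{2}{k+2}+\epsilon)\cdot\mathbb{E}[\mathsf{ADV}]-c$, where $\mathsf{ALG}$ is the cardinality of the algorithm's final matching and $\mathsf{ADV}$ is the cardinality of the matching that the adversary constructs online.
   Context: Problem: $G=(V,E)$ is a graph, not necessarily bipartite. The algorithm initially knows $V$ and $k$. Over $|E|$ timesteps the edges of $G$ are revealed one at a time. At the end of each timestep the algorithm must output a matching in the graph revealed so far. The new matching $M_2$ must be obtainable from the previous matching $M_1$ (empty before the first timestep) by at most $k$ (re)assignments, the number of (re)assignments being the number of vertices of nonzero degree in $M_1\triangle M_2$; once a vertex is matched it must remain matched at all later timesteps. An adaptive online adversary chooses each next edge depending on the algorithm's behavior so far, and must itself construct its own solution (a matching) online as the edges are revealed, without knowledge of the algorithm's future random choices; the algorithm is compared against the value $\mathsf{ADV}$ of this online solution. *)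

(* Defs.v *)
From HB Require Import structures.
From mathcomp Require Import all_boot all_order all_algebra.
From mathcomp Require Import reals.
Set Implicit Arguments. Unset Strict Implicit. Unset Printing Implicit Defensive.
Import Order.TTheory GRing.Theory Num.Theory.
Local Open Scope ring_scope.

Definition is_edge n (e : {set 'I_n}) : bool := #|e| == 2%N.

Definition is_matching n (G M : {set {set 'I_n}}) : bool :=
  (M \subset G) && trivIset M.

Definition reassignments n (M1 M2 : {set {set 'I_n}}) : nat :=
  #|cover ((M1 :\: M2) :|: (M2 :\: M1))|.

Definition valid_update n (k : nat) (G M1 M2 : {set {set 'I_n}}) : bool :=
  [&& is_matching G M2, (reassignments M1 M2 <= k)%N & cover M1 \subset cover M2].

Fixpoint legal_from n (k : nat) (es : seq {set 'I_n}) (M0 : {set {set 'I_n}})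
    (h : seq ({set 'I_n} * {set {set 'I_n}})) : bool :=
  match h with
  | [::] => true
  | (e, M) :: h' =>
      [&& is_edge e, e \notin es,
          valid_update k [set x in rcons es e] M0 M
        & legal_from k (rcons es e) M h']
  end.

Definition legal_hist n (k : nat) (h : seq ({set 'I_n} * {set {set 'I_n}})) :=
  legal_from k [::] set0 h.

(* A full step: ((revealed edge, adversary's matching), algorithm's matching). *)
Definition step n := ({set 'I_n} * {set {set 'I_n}} * {set {set 'I_n}})%type.

Definition alg_view n (h : seq (step n)) : seq ({set 'I_n} * {set {set 'I_n}}) :=
  [seq (s.1.1, s.2) | s <- h].
Definition adv_view n (h : seq (step n)) : seq ({set 'I_n} * {set {set 'I_n}}) :=
  [seq s.1 | s <- h].

(* Randomized online algorithm (behavioural form): knowing V = 'I_n, the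
   edges revealed so far and its own previous matchings, on arrival of a new
   edge it outputs a probability distribution over the next matching. *)
Definition rand_alg (R : realType) :=
  forall n : nat, seq ({set 'I_n} * {set {set 'I_n}}) -> {set 'I_n} ->
    {ffun {set {set 'I_n}} -> R}.

Definition valid_alg (R : realType) (k : nat) (alg : rand_alg R) : Prop :=
  forall n (h : seq ({set 'I_n} * {set {set 'I_n}})) (e : {set 'I_n}),
    legal_hist k h -> is_edge e -> e \notin [seq s.1 | s <- h] ->
    [/\ forall M, 0 <= alg n h e M,
        \sum_(M : {set {set 'I_n}}) alg n h e M = 1
      & forall M, 0 < alg n h e M ->
          valid_update k [set x in rcons [seq s.1 | s <- h] e]
                       (last set0 [seq s.2 | s <- h]) M].

(* Adaptive online adversary on vertex set 'I_n: given the whole history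
   (edges, its own matchings, the algorithm's realized matchings) it either
   stops (None) or reveals a new edge together with its own new matching
   (chosen online, at the moment the edge is revealed). *)
Definition adversary n :=
  seq (step n) -> option ({set 'I_n} * {set {set 'I_n}}).

Definition valid_adv n (k : nat) (adv : adversary n) : Prop :=
  forall h : seq (step n),
    legal_hist k (alg_view h) -> legal_hist k (adv_view h) ->
    match adv h with
    | None => true
    | Some (e, A) =>
        [&& is_edge e, e \notin [seq s.1.1 | s <- h] &
            valid_update k [set x in rcons [seq s.1.1 | s <- h] e]
                         (last set0 [seq s.1.2 | s <- h]) A]
    end.

Fixpoint exp_val (R : realType) n (alg : rand_alg R) (adv : adversary n)
    (f : seq (step n) -> R) (F : nat) (h : seq (step n)) : R :=
  match F with
  | 0%N => f h
  | F'.+1 =>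
      match adv h with
      | None => f h
      | Some (e, A) =>
          \sum_(M : {set {set 'I_n}})
             alg n (alg_view h) e M * exp_val alg adv f F' (rcons h (e, A, M))
      end
  end.

(* A simple graph on n vertices has at most 'C(n,2) edges, so every play
   against a valid adversary ends within 'C(n,2) timesteps. *)
Definition final_alg n (h : seq (step n)) : nat := #|last set0 [seq s.2 | s <- h]|.
Definition final_adv n (h : seq (step n)) : nat := #|last set0 [seq s.1.2 | s <- h]|.

Definition E_ALG (R : realType) n (alg : rand_alg R) (adv : adversary n) : R :=
  exp_val alg adv (fun h => (final_alg h)%:R) 'C(n, 2) [::].
Definition E_ADV (R : realType) n (alg : rand_alg R) (adv : adversary n) : R :=
  exp_val alg adv (fun h => (final_adv h)%:R) 'C(n, 2) [::].

(* Main.v *)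
Require Import Defs.
From HB Require Import structures.
From mathcomp Require Import all_boot all_order all_algebra.
From mathcomp Require Import reals.
From mathcomp Require Import zify ring lra.
Import Order.TTheory GRing.Theory Num.Theory.
Set Implicit Arguments. Unset Strict Implicit. Unset Printing Implicit Defensive.

(** Write k = 2m.  The adversary grows N disjoint paths from their middle edges:
    whenever the algorithm covers an end of a path with fewer than 2m+1 edges, the path
    is prolonged at that end.  Vertices never become unmatched and a path with 2m+2
    vertices cannot be augmented with k reassignments, so once no path can be prolonged
    each one carries l <= m edges of the algorithm's matching out of a maximum of l+1.
    When no path is to be prolonged the adversary reveals edges of a star, which can
    contribute only one edge to the algorithm's matching.

    The edges revealed depend only on the algorithm's matchings, and the algorithm does
    not see the adversary's matching.  Hence the time when the adversary starts to build
    its own matching can be hidden: split the time into L blocks.  The expected size of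
    the algorithm's matching is nondecreasing and O(N), so during some block it grows by
    O(N/L) only.  In that block the adversary waits until no path can be prolonged, adds
    the complementary matching of the paths one edge at a time, and then stops. *)

(** * Disjoint families, alternating sequences and prefixes *)

Lemma trivIset_eq (V : finType) (M : {set {set V}}) (A B : {set V}) (x : V) :
  trivIset M -> A \in M -> B \in M -> x \in A -> x \in B -> A = B.
Proof.
move=> /trivIsetP tM AM BM xA xB; apply/eqP/negPn/negP => nAB.
by have /disjointFr/(_ xA) := tM A B AM BM nAB; rewrite xB.
Qed.

(** Exactly one of two consecutive values is true. Applied to the indicator of the matching edges
    along a path. *)
Lemma alternating (x : nat -> bool) a b :
  (forall p, a <= p -> p.+1 < b -> ~~ (x p && x p.+1)) ->
  (forall q, a < q < b -> x q.-1 || x q) ->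
  forall d, a + d < b -> x (a + d) = x a (+) odd d.
Proof.
move=> x2 x1; elim=> [|d IHd] ltb; first by rewrite addn0 addbF.
rewrite addnS in ltb *; have {IHd} xd := IHd (ltnW ltb).
have /= := x1 (a + d).+1; rewrite ltb ltnS leq_addr => /(_ isT).
have := x2 (a + d); rewrite ltb leq_addr => /(_ isT isT).
by rewrite xd /= addbN; case: (x a (+) odd d); case: (x _).
Qed.

Lemma takel_rcons (V : Type) t (s : seq V) x : t <= size s -> take t (rcons s x) = take t s.
Proof. by move=> ts; rewrite -cats1 takel_cat. Qed.

(** * The paths and the star *)

Section Gadgets.

Variables N m T : nat.

Let K := m.*2.+2.

(** N paths with room for 2m+2 vertices each, then the centre, then T leaves, so that a fresh star
    edge is available in each of T timesteps. *)
Definition nverts := (N * m.*2.+2 + T).+1.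

Definition pvert (i p : nat) : 'I_nverts := inord (i * m.*2.+2 + p).
Definition center : 'I_nverts := inord (N * m.*2.+2).
Definition leaf (t : nat) : 'I_nverts := inord (N * m.*2.+2 + t.+1).
Definition pedge (i p : nat) : {set 'I_nverts} := [set pvert i p; pvert i p.+1].
Definition sedge (t : nat) : {set 'I_nverts} := [set center; leaf t].

Lemma code_lt i p : i < N -> p < K -> i * K + p < N * K.
Proof. rewrite /K => iN pK; nia. Qed.

Lemma pvertE i p : i < N -> p < K -> pvert i p = i * K + p :> nat.
Proof.
by move=> iN pK; rewrite inordK // ltnS (leq_trans (ltnW (code_lt iN pK))) ?leq_addr.
Qed.

Lemma centerE : center = N * K :> nat.
Proof. by rewrite inordK // ltnS leq_addr. Qed.

Lemma leafE t : t < T -> leaf t = N * K + t.+1 :> nat.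
Proof. by move=> tT; rewrite inordK // ltnS leq_add2l. Qed.

Lemma pvert_inj i p i' p' : i < N -> p < K -> i' < N -> p' < K ->
  pvert i p = pvert i' p' -> i = i' /\ p = p'.
Proof.
move=> iN pK iN' pK' /(congr1 val); rewrite /= !pvertE // => e.
split; first by have := congr1 (divn^~ K) e; rewrite !divnMDl ?divn_small ?addn0.
by have := congr1 (modn^~ K) e; rewrite !modnMDl !modn_small.
Qed.

Lemma pvert_sedge i p t : i < N -> p < K -> t < T -> pvert i p \notin sedge t.
Proof.
move=> iN pK tT; have lt := code_lt iN pK.
rewrite !inE -!val_eqE /= pvertE // centerE leafE //; lia.
Qed.

Lemma pvert_pedge i p i' p' : i < N -> p < K -> i' < N -> p' < m.*2.+1 ->
  (pvert i p \in pedge i' p') = (i == i') && ((p == p') || (p == p'.+1)).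
Proof.
move=> iN pK iN' pK'; rewrite !inE.
apply/idP/idP => [|/andP[/eqP-> /orP[]/eqP->]]; rewrite ?eqxx ?orbT //.
by case/orP => /eqP/pvert_inj => /(_ iN pK iN') [] //; rewrite ?ltnS // 1?ltnW //
  => -> ->; rewrite !eqxx ?orbT.
Qed.

Lemma pedge_inj i p i' p' : i < N -> p < m.*2.+1 -> i' < N -> p' < m.*2.+1 ->
  pedge i p = pedge i' p' -> i = i' /\ p = p'.
Proof.
move=> iN pK iN' pK' e.
have: pvert i p \in pedge i' p' by rewrite -e !inE eqxx.
have: pvert i p.+1 \in pedge i' p' by rewrite -e !inE eqxx orbT.
rewrite !pvert_pedge //; first by lia.
by rewrite ltnW.
Qed.

Lemma pedge_sedge i p t : i < N -> p < m.*2.+1 -> t < T -> pedge i p != sedge t.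
Proof.
move=> iN pK tT; apply/eqP => e.
have /negP := pvert_sedge iN (ltnW pK : p < K) tT.
by rewrite -e !inE eqxx.
Qed.

Lemma sedge_inj t t' : t < T -> t' < T -> sedge t = sedge t' -> t = t'.
Proof.
move=> tT tT' e.
have: leaf t \in sedge t' by rewrite -e !inE eqxx orbT.
by rewrite !inE -!val_eqE /= centerE !leafE //; lia.
Qed.

Lemma is_edge_pedge i p : i < N -> p < m.*2.+1 -> is_edge (pedge i p).
Proof.
move=> iN pK; rewrite /is_edge cards2.
case: (pvert i p =P pvert i p.+1) => // /pvert_inj[] //; last by lia.
exact: ltnW.
Qed.

Lemma is_edge_sedge t : t < T -> is_edge (sedge t).
Proof.
move=> tT; rewrite /is_edge cards2 -val_eqE /= centerE leafE //.
by rewrite -{1}[N * K]addn0 eqn_add2l.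
Qed.

Implicit Types (E : seq {set 'I_nverts}) (M : {set {set 'I_nverts}}).

(** The bound [size E] on the indices makes [sedge (size E)] new; the bound T keeps [leaf]
    injective. *)
Definition board E : Prop := forall e, e \in E ->
  (exists i p, [/\ i < N, p < m.*2.+1 & e = pedge i p]) \/
  (exists2 t, t < minn (size E) T & e = sedge t).

Definition cov M i p := pvert i p \in cover M.

Definition matches E M := is_matching [set x in E] M.

Lemma matches_sub E M e : matches E M -> e \in M -> e \in E.
Proof. by case/andP => /subsetP sM _ /sM; rewrite inE. Qed.

Lemma matches_rcons E M e : matches E M -> matches (rcons E e) M.
Proof.
case/andP => /subsetP sM tM; apply/andP; split=> //; apply/subsetP => x /sM.
by rewrite !inE mem_rcons inE => ->; rewrite orbT.
Qed.

(** The guards matter at the ends of the path: [pvert i m.*2.+2] is already the first vertex of the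
    next path (or the centre), and [0.-1] is 0. *)
Lemma covE E M i q : board E -> matches E M -> i < N -> q < K ->
  cov M i q = (q < m.*2.+1) && (pedge i q \in M) || (0 < q) && (pedge i q.-1 \in M).
Proof.
move=> bE mM iN qK; apply/bigcupP/idP => [[e eM qe]|].
  case: (bE e (matches_sub mM eM)) => [[i' [p [iN' pK eq_e]]]|[t tT eq_e]].
    move: qe eM; rewrite eq_e pvert_pedge // => /andP[/eqP<-].
    by case/orP => /eqP-> -> /=; rewrite ?pK ?orbT.
  have /negP[] := @pvert_sedge i q t iN qK (leq_trans tT (geq_minr _ _)).
  by rewrite -eq_e.
case/orP => /andP[q0 eM]; first by exists (pedge i q); rewrite // !inE eqxx.
exists (pedge i q.-1) => //; by rewrite !inE prednK // eqxx orbT.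
Qed.

Lemma pedge_consecutive E M i p : matches E M ->
  i < N -> p.+1 < m.*2.+1 -> ~~ ((pedge i p \in M) && (pedge i p.+1 \in M)).
Proof.
case/andP => _ tM iN pK; apply/negP => /andP[pM pM'].
have := trivIset_eq tM pM pM' (x := pvert i p.+1); rewrite !inE eqxx orbT.
by move=> /(_ isT isT) /pedge_inj[] //; [exact: ltnW | move=> _; lia].
Qed.

(** Inner vertices are covered because a path is prolonged only at a covered end and covered
    vertices stay covered. *)
Definition spans E M i a b := [/\ a <= m, m < b <= m.*2.+1,
  forall p, p < m.*2.+1 -> (pedge i p \in E) = (a <= p < b) &
  forall q, a < q < b -> cov M i q].

(* a + b = m.*2.+1 when the path with vertices a, ..., b is symmetric around its middle
   edge; otherwise it has just been prolonged at one end, which is still uncovered. *)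
Definition shape M i a b := [\/ a + b = m.*2.+1 /\ (a = 0 -> ~~ cov M i a),
  a + b = m.*2 /\ ~~ cov M i a | a + b = m.*2.+2 /\ ~~ cov M i b].

Section OnePath.

Variables (E : seq {set 'I_nverts}) (M : {set {set 'I_nverts}}) (i a b : nat).
Hypotheses (bE : board E) (mM : matches E M) (iN : i < N) (sp : spans E M i a b).

Lemma spans_pedge p : p < m.*2.+1 -> pedge i p \in M -> a <= p < b.
Proof. by case: sp => _ _ eE _ pK /(matches_sub mM); rewrite eE. Qed.

Lemma cov_left : cov M i a = (pedge i a \in M).
Proof.
case: sp => am /andP[mb bK] eE _.
rewrite (covE bE mM iN) /K; last by lia.
have -> /= : a < m.*2.+1 by lia.
case: (posnP a) => [->|a0]; first by rewrite orbF.
rewrite orbC; case: (boolP (pedge i a.-1 \in M)) => //= /spans_pedge.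
by lia.
Qed.

Lemma cov_right : cov M i b = (pedge i b.-1 \in M).
Proof.
case: sp => am /andP[mb bK] eE _.
rewrite (covE bE mM iN) /K; last by lia.
have -> /= : 0 < b by lia.
case: (boolP (_ && _)) => //= /andP[bK' /(spans_pedge bK')].
by lia.
Qed.

Lemma spans_alternating d : a + d < b ->
  (pedge i (a + d) \in M) = cov M i a (+) odd d.
Proof.
rewrite cov_left; case: sp => am /andP[mb bK] eE inn.
apply: (@alternating (fun p => pedge i p \in M)) => [p ap pb|q qab].
  by apply: pedge_consecutive mM iN _; lia.
have := inn q qab; rewrite (covE bE mM iN); last by rewrite /K; lia.
by have [-> ->] : q < m.*2.+1 /\ 0 < q by [lia]; rewrite orbC.
Qed.

(** An end is covered iff its last edge is in M, so alternation ties the two ends: both or neither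
    is covered if the length is odd, exactly one if it is even. *)
Lemma cov_ends : cov M i b = cov M i a (+) odd (a + b).+1.
Proof.
case: sp => am /andP[mb bK] eE inn.
rewrite cov_right -(_ : a + (b.-1 - a) = b.-1) ?spans_alternating; lia.
Qed.

End OnePath.

Lemma spans_mono E M M' i a b : cover M \subset cover M' ->
  spans E M i a b -> spans E M' i a b.
Proof.
move=> /subsetP cM [am mb eE inn]; split=> // q /inn; exact: cM.
Qed.

(* M1 and M2 alternate along the path in opposite phases. *)
Lemma full_path_stuck E M1 M2 i : board E -> matches E M1 -> matches E M2 -> i < N ->
  spans E M1 i 0 m.*2.+1 -> spans E M2 i 0 m.*2.+1 ->
  ~~ cov M1 i 0 -> cov M2 i 0 -> m.*2.+2 <= reassignments M1 M2.
Proof.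
move=> bE mM1 mM2 iN sp1 sp2 c1 c2.
have alt1 d := @spans_alternating E M1 i 0 m.*2.+1 bE mM1 iN sp1 d.
have alt2 d := @spans_alternating E M2 i 0 m.*2.+1 bE mM2 iN sp2 d.
rewrite -[m.*2.+2]card_ord -(@card_imset _ _ (fun q : 'I_K => pvert i q)); last first.
  by move=> q q' /pvert_inj[] // _ /val_inj.
apply: subset_leq_card; apply/subsetP => _ /imsetP[q _ ->].
(* The edges of even index lie in [M2] and not in [M1], and they already cover all vertices of the
   path. *)
apply/bigcupP; case: (boolP (odd q)) => oq.
  have q0 : 0 < q by case: (val q) oq.
  have pq : q.-1 < m.*2.+1 by have := ltn_ord q; rewrite /K; lia.
  have opq : ~~ odd q.-1 by lia.
  exists (pedge i q.-1); last by rewrite !inE prednK // eqxx orbT.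
  have := alt1 _ pq; have := alt2 _ pq; rewrite !add0n => e2 e1.
  by rewrite !inE e1 e2 (negbTE c1) c2 (negbTE opq).
have pq : q < m.*2.+1.
  have qK : q < m.*2.+2 := ltn_ord q.
  rewrite ltn_neqAle -ltnS qK andbT; apply: contraNneq oq => -> /=.
  by rewrite odd_double.
exists (pedge i q); last by rewrite !inE eqxx.
have := alt1 _ pq; have := alt2 _ pq; rewrite !add0n => e2 e1.
by rewrite !inE e1 e2 (negbTE c1) c2 (negbTE oq).
Qed.

(** In a path of even length the covered end stays covered, so by [cov_ends] the other end stays
    uncovered. For a full path, covering its ends would take 2m+2 > k reassignments. *)
Lemma shape_update E M1 M2 i a b : board E -> matches E M1 ->
  valid_update m.*2 [set x in E] M1 M2 -> i < N ->
  spans E M1 i a b -> shape M1 i a b -> shape M2 i a b.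
Proof.
move=> bE mM1 /and3P[mM2 re cM] iN sp1 sh.
have sp2 := spans_mono cM sp1.
have ce1 := cov_ends bE mM1 iN sp1; have ce2 := cov_ends bE mM2 iN sp2.
have cov12 q : cov M1 i q -> cov M2 i q by move: q => q; apply: (subsetP cM).
case: sh => -[eab c1].
- apply: Or31; split=> // a0; rewrite a0 in eab c1 sp1 sp2 *.
  rewrite -[b]add0n eab in sp1 sp2.
  apply/negP => c2.
  have := full_path_stuck bE mM1 mM2 iN sp1 sp2 (c1 erefl) c2.
  by move: re; lia.
- apply: Or32; split=> //; apply: contraNN c1 => c2.
  have := cov12 b; rewrite ce1 ce2 c2 eab /= odd_double /=.
  by case: (cov M1 i a) => //= /(_ isT).
- apply: Or33; split=> //; apply: contraNN c1 => c2.
  have := cov12 a; move: c2; rewrite ce1 ce2 eab /= !negbK odd_double /=.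
  by case: (cov M1 i a) => //=; case: (cov M2 i a) => //= _ /(_ isT).
Qed.

(** The middle edge starts a path. Any other edge is tested at the vertex it shares with its
    neighbour towards the middle, which is the current end of the path. *)
Definition wanted E M (i p : nat) : bool :=
  (pedge i p \notin E) &&
  [|| p == m, [&& p < m, pedge i p.+1 \in E & cov M i p.+1]
    | [&& m < p, pedge i p.-1 \in E & cov M i p]].

Definition quiet E M := [forall q : 'I_N * 'I_m.*2.+1, ~~ wanted E M q.1 q.2].

Definition next_edge E M : {set 'I_nverts} :=
  if [pick q : 'I_N * 'I_m.*2.+1 | wanted E M q.1 q.2] is Some q
  then pedge q.1 q.2 else sedge (size E).

Definition balanced E M := [/\ board E, matches E M &
  forall i, i < N -> (forall p, p < m.*2.+1 -> pedge i p \notin E) \/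
                     (exists a b, spans E M i a b /\ shape M i a b)].

(** * The growth of the paths *)

Lemma next_edge_fresh E M : board E -> size E < T ->
  is_edge (next_edge E M) /\ next_edge E M \notin E.
Proof.
move=> bE sE; rewrite /next_edge; case: pickP => [[i p] /= /andP[pE _]|_].
  by split=> //; apply: is_edge_pedge.
split; first exact: is_edge_sedge.
apply/negP => /bE[[i [p [iN pK e]]]|[t]].
  by have /eqP[] := pedge_sedge iN pK sE.
by rewrite leq_min => /andP[tE tT] /(sedge_inj sE tT) e; rewrite e ltnn in tE.
Qed.

Lemma board_rcons_pedge E i p : board E -> i < N -> p < m.*2.+1 ->
  board (rcons E (pedge i p)).
Proof.
move=> bE iN pK e; rewrite mem_rcons inE => /orP[/eqP->|/bE[|[t tE ->]]].
- by left; exists i, p.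
- by left.
- by right; exists t => //; rewrite size_rcons; lia.
Qed.

Lemma board_rcons_sedge E : board E -> size E < T -> board (rcons E (sedge (size E))).
Proof.
move=> bE sE e; rewrite mem_rcons inE => /orP[/eqP->|/bE[|[t tE ->]]].
- by right; exists (size E) => //; rewrite size_rcons; lia.
- by left.
- by right; exists t => //; rewrite size_rcons; lia.
Qed.

Lemma balanced_rcons_other E M i e : i < N ->
  (forall p, p < m.*2.+1 -> pedge i p != e) ->
  (forall p, p < m.*2.+1 -> pedge i p \notin E) \/
    (exists a b, spans E M i a b /\ shape M i a b) ->
  (forall p, p < m.*2.+1 -> pedge i p \notin rcons E e) \/
    (exists a b, spans (rcons E e) M i a b /\ shape M i a b).
Proof.
move=> iN ne [noE|[a [b [[am mb eE inn] sh]]]].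
  by left=> p pK; rewrite mem_rcons inE negb_or ne ?noE.
right; exists a, b; split=> //; split=> // p pK.
by rewrite mem_rcons inE (negbTE (ne p pK)) eE.
Qed.

Lemma mem_rcons_pedge E i p q : i < N -> p < m.*2.+1 -> q < m.*2.+1 ->
  (pedge i q \in rcons E (pedge i p)) = (q == p) || (pedge i q \in E).
Proof.
move=> iN pK qK; rewrite mem_rcons inE; congr (_ || _).
apply/eqP/eqP => [/pedge_inj[]//|-> //].
Qed.

Lemma cov_outside E M i a b q : board E -> matches E M -> i < N -> spans E M i a b ->
  q < K -> (q < a) || (b < q) -> ~~ cov M i q.
Proof.
move=> bE mM iN sp qK qab; rewrite (covE bE mM iN qK) negb_or.
case: (sp) => am /andP[mb bK] eE _.
apply/andP; split; apply/negP => /andP[q0 /(spans_pedge mM sp)]; last by lia.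
by move=> /(_ q0); lia.
Qed.

(** The prolonged end is covered, so it is not the fresh end of a lopsided path. Hence a symmetric
    path becomes lopsided, and a lopsided one becomes symmetric again. The new end is uncovered
    since no revealed edge met it before. *)
Lemma extend_left E M i a b p : board E -> matches E M -> i < N ->
  spans E M i a b -> shape M i a b -> a = p.+1 -> cov M i a ->
  spans (rcons E (pedge i p)) M i p b /\ shape M i p b.
Proof.
move=> bE mM iN sp sh ea ca; have out := cov_outside bE mM iN sp.
case: (sp) => am /andP[mb bK] eE inn; split; first split=> //; try lia.
- by move=> q qK; rewrite mem_rcons_pedge ?eE //; lia.
- move=> q /andP[pq qb]; case: (ltnP a q) => aq; first by apply: inn; rewrite aq.
  by have -> : q = a by lia.
have cp : ~~ cov M i p by apply: out; rewrite ?ea /K //; lia.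
case: sh => -[eab c1].
- by apply: Or32; split=> //; lia.
- by rewrite ca in c1.
- by apply: Or31; split=> //; lia.
Qed.

Lemma extend_right E M i a b : board E -> matches E M -> i < N -> b < m.*2.+1 ->
  spans E M i a b -> shape M i a b -> cov M i b ->
  spans (rcons E (pedge i b)) M i a b.+1 /\ shape M i a b.+1.
Proof.
move=> bE mM iN bK' sp sh cb; have out := cov_outside bE mM iN sp.
case: (sp) => am /andP[mb bK] eE inn; split; first split=> //; try lia.
- by move=> q qK; rewrite mem_rcons_pedge ?eE //; lia.
- move=> q /andP[aq qb]; case: (ltnP q b) => bq; first by apply: inn; rewrite aq.
  by have -> : q = b by lia.
have cp : ~~ cov M i b.+1 by apply: out; rewrite /K ?ltnSn ?orbT //.
case: sh => -[eab c1].
- by apply: Or33; split=> //; lia.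
- by apply: Or31; split=> //; lia.
- by rewrite cb in c1.
Qed.

Lemma balanced_next E M : balanced E M -> size E < T ->
  balanced (rcons E (next_edge E M)) M.
Proof.
case=> bE mM cE sE; rewrite /next_edge; case: pickP => [[[i iN] [p pK]] /=|_]; last first.
  split; [exact: board_rcons_sedge|exact: matches_rcons|move=> i iN].
  by apply: balanced_rcons_other (cE i iN) => // p pK; apply: pedge_sedge.
move=> /andP[pE wE].
split; [exact: board_rcons_pedge|exact: matches_rcons|move=> j jN].
have [eij|neij] := eqVneq j i; last first.
  apply: balanced_rcons_other (cE j jN) => // q qK.
  by apply: contra_neq neij => /pedge_inj[].
rewrite {j jN}eij; right; case: (cE i iN) => [noE|[a [b [sp sh]]]].
  have {wE} epm : p = m.
    case/or3P: wE => [/eqP //|/and3P[pm +]|/and3P[pm +]].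
      by rewrite (negbTE (noE _ _)) //; lia.
    by rewrite (negbTE (noE _ _)) //; lia.
  rewrite {}epm in pK pE *; exists m, m.+1.
  split; first split=> //; try lia.
    by move=> q qK; rewrite mem_rcons_pedge // (negbTE (noE q qK)) orbF; lia.
  apply: Or31; split=> [|_]; first by lia.
  rewrite (covE bE mM iN) ?negb_or /K; last by lia.
  apply/andP; split; apply/negP => /andP[m0 /(matches_sub mM)];
    by rewrite (negbTE (noE _ _)) //; lia.
case: (sp) => am /andP[mb bK] eE inn.
rewrite eE // in pE; case/or3P: wE => [/eqP pm|/and3P[pm]|/and3P[pm]].
- by move: pE; rewrite pm; lia.
- rewrite eE; last by lia.
  move=> pab; have ea : a = p.+1 by lia.
  rewrite -ea => ca; exists p, b; exact: (extend_left bE mM iN sp sh ea ca).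
- rewrite eE; last by lia.
  move=> pab; have eb : p = b by lia.
  rewrite {}eb in pK pE pm pab * => cb.
  exists a, b.+1; exact: extend_right.
Qed.

Lemma balanced_update E M M' : balanced E M ->
  valid_update m.*2 [set x in E] M M' -> balanced E M'.
Proof.
case=> bE mM cE vu; case/and3P: (vu) => mM' _ cM.
split=> // i iN; case: (cE i iN) => [|[a [b [sp sh]]]]; [by left|right].
exists a, b; split; first exact: spans_mono cM sp.
exact: shape_update bE mM vu iN sp sh.
Qed.

(** A lopsided path has even length, so its older end is covered; that end can still be prolonged,
    contradicting quietness. In a symmetric path the ends are uncovered by quietness, or by [shape]
    when the path is full. *)
Lemma quiet_spans E M i : balanced E M -> quiet E M -> i < N ->
  exists a b, [/\ spans E M i a b, a + b = m.*2.+1 & ~~ cov M i a].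
Proof.
case=> bE mM cE /forallP qE iN.
have nw p : p < m.*2.+1 -> ~~ wanted E M i p by move=> pK; apply: (qE (Ordinal iN, Ordinal pK)).
case: (cE i iN) => [noE|[a [b [sp sh]]]].
  have mK : m < m.*2.+1 by lia.
  by have := nw m mK; rewrite /wanted noE ?eqxx.
exists a, b; have ce := cov_ends bE mM iN sp.
case: (sp) => am /andP[mb bK] eE inn.
have ca : a != 0 -> ~~ cov M i a.
  case: a {sp sh ce} am eE inn => // p am eE _ _.
  have pK : p < m.*2.+1 by lia.
  have := nw p pK; rewrite /wanted (eE p) // (eE p.+1); last by lia.
  have [-> -> ->] : [/\ p.+1 <= p < b = false, p < m & p < p.+1 < b] by split; lia.
  by apply: contraNN => ->; rewrite orbT.
have cb : b != m.*2.+1 -> ~~ cov M i b.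
  move=> b0; have bK' : b < m.*2.+1 by lia.
  have := nw b bK'; rewrite /wanted.
  have [-> -> ->] : [/\ b == m = false, b < m = false & m < b] by split; lia.
  have bK1 : b.-1 < m.*2.+1 by lia.
  rewrite (eE b) // (eE b.-1) //.
  have -> : (a <= b < b) = false by lia.
  have -> : a <= b.-1 < b by lia.
  by apply: contraNN => ->.
case: sh => -[eab c1].
- split=> //; case: (eqVneq a 0) => [/c1 //|]; exact: ca.
- have bK' : b != m.*2.+1 by lia.
  by have := cb bK'; rewrite ce eab (negbTE c1) /= odd_double.
- have a0 : a != 0 by lia.
  by move: c1; rewrite ce eab (negbTE (ca a0)) /= odd_double.
Qed.

(** * The matchings on paths that cannot be prolonged *)

(** The first edge is outside M because the end a is uncovered; the last revealed edge has index b -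
    1 = 2m - a. *)
Lemma quiet_alternates E M i : balanced E M -> quiet E M -> i < N ->
  exists a, [/\ a <= m,
    forall p, p < m.*2.+1 -> (pedge i p \in E) = (a <= p <= m.*2 - a) &
    forall p, p < m.*2.+1 -> (pedge i p \in M) = (a <= p <= m.*2 - a) && odd (p - a)].
Proof.
move=> bal qu iN; have [a [b [sp eab ca]]] := quiet_spans bal qu iN.
case: bal => bE mM _; case: (sp) => am /andP[mb bK] eE _.
exists a; split=> // p pK; first by rewrite eE //; lia.
case: (boolP (a <= p <= m.*2 - a)) => [/andP[ap pb]|]; last first.
  by apply: contraNF => /(spans_pedge mM sp pK); lia.
by rewrite -{1}(subnKC ap) (spans_alternating bE mM iN sp) ?(negbTE ca); lia.
Qed.

(** The matching the adversary aims at. Star edges are left out, as they all meet in the centre. *)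
Definition rest E M : {set {set 'I_nverts}} :=
  [set pedge q.1 q.2 | q : 'I_N * 'I_m.*2.+1 in
     [set q : 'I_N * 'I_m.*2.+1 | (pedge q.1 q.2 \in E) && (pedge q.1 q.2 \notin M)]].

Lemma rest_sub E M e : e \in rest E M -> e \in E.
Proof. by case/imsetP => q; rewrite inE => /andP[qE _] ->. Qed.

Lemma card_rest E M : #|rest E M| <= N * m.*2.+1.
Proof.
apply: leq_trans (leq_imset_card _ _) _.
by apply: leq_trans (max_card _) _; rewrite card_prod !card_ord.
Qed.

(** Distinct path edges with a common vertex are consecutive, and of two consecutive revealed edges
    one is in M. *)
Lemma quiet_rest_trivIset E M : balanced E M -> quiet E M -> trivIset (rest E M).
Proof.
move=> bal qu; apply/trivIsetP => A B /imsetP[[i p] /= + ->] /imsetP[[j q] /= + ->].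
rewrite !inE /= => /andP[pE pM] /andP[qE qM] neq.
apply/pred0P => x /=; apply/negbTE/negP => /andP[xp xq].
have epq : i = j /\ (p = q \/ p = q.+1 :> nat \/ p.+1 = q :> nat).
  move: xp; rewrite !inE => /orP[] /eqP ex; move: xq;
    rewrite ex pvert_pedge //; try exact: (ltnW (ltn_ord p)); try exact: (ltn_ord p);
    case/andP => /eqP/val_inj -> /orP[] /eqP e; split=> //.
  - by left; apply: val_inj.
  - by right; left.
  - by right; right.
  - by left; apply: val_inj; case: e.
case: epq => eij epq; subst j.
have [a [am eE eM]] := quiet_alternates bal qu (ltn_ord i).
move: pE pM qE qM; rewrite !eM ?eE // => pE + qE; rewrite pE qE /=.
case: epq => [epq|]; first by rewrite epq eqxx in neq.
by lia.
Qed.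

(** The path has 2(m - a) + 1 edges, alternating, with the first and the last outside M; so l = m -
    a. *)
Lemma quiet_row E M (i : 'I_N) : balanced E M -> quiet E M ->
  exists2 l, l <= m &
    #|[set p : 'I_m.*2.+1 | pedge i p \in M]| <= l /\
    l < #|[set p : 'I_m.*2.+1 | (pedge i p \in E) && (pedge i p \notin M)]|.
Proof.
move=> bal qu; have [a [am eE eM]] := quiet_alternates bal qu (ltn_ord i).
exists (m - a); first exact: leq_subr; split.
  pose f (y : 'I_(m - a)) : 'I_m.*2.+1 := inord (a + y.*2.+1).
  rewrite -[X in _ <= X]card_ord; apply: leq_trans (leq_imset_card f _).
  apply: subset_leq_card; apply/subsetP => p; rewrite inE eM // => /andP[pab op].
  have eh := odd_double_half (p - a); rewrite op in eh.
  have ly : (p - a)./2 < m - a by lia.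
  apply/imsetP; exists (Ordinal ly) => //; apply: val_inj.
  by rewrite /= inordK /=; lia.
pose f (y : 'I_(m - a).+1) : 'I_m.*2.+1 := inord (a + y.*2).
have fE y : f y = a + y.*2 :> nat.
  by have yl := ltn_ord y; rewrite inordK //; lia.
rewrite -[X in X <= _]card_ord -(@card_imset _ _ f); last first.
  by move=> y z /(congr1 val); rewrite /= !fE => e; apply: val_inj; rewrite /=; lia.
apply: subset_leq_card; apply/subsetP => _ /imsetP[y _ ->].
have := ltn_ord y; rewrite inE eM // eE // fE; lia.
Qed.

Lemma card_pairs (I J : finType) (P : I -> J -> bool) :
  #|[set q : I * J | P q.1 q.2]| = \sum_i #|[set j | P i j]|.
Proof.
under eq_bigr => i _ do rewrite cardsE -sum1_card.
rewrite pair_big_dep /= -sum1_card; apply: eq_bigl => q.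
by rewrite inE.
Qed.

(** The extra edge is the only star edge a matching can contain. *)
Lemma card_matching E M : balanced E M ->
  #|M| <= #|[set q : 'I_N * 'I_m.*2.+1 | pedge q.1 q.2 \in M]|.+1.
Proof.
case=> bE mM _; pose S := [set e in M | center \in e].
have S1 : #|S| <= 1.
  apply/card_le1_eqP => A B; rewrite !inE => /andP[AM cA] /andP[BM cB].
  by case/andP: mM => _ tM; apply: trivIset_eq tM _ _ _ _; eassumption.
pose f (q : 'I_N * 'I_m.*2.+1) := pedge q.1 q.2.
have sM : M \subset [set f q | q in [set q : 'I_N * 'I_m.*2.+1 | pedge q.1 q.2 \in M]] :|: S.
  apply/subsetP => e eM; rewrite inE.
  case: (bE e (matches_sub mM eM)) => [[i [p [iN pK ee]]]|[t _ ee]].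
    apply/orP; left; apply/imsetP; exists (Ordinal iN, Ordinal pK) => //.
    by rewrite inE /= -ee.
  by apply/orP; right; rewrite inE eM ee !inE eqxx.
apply: leq_trans (subset_leq_card sM) _; apply: leq_trans (leq_card_setU _ _) _.
by rewrite -[X in _ <= X]addn1 leq_add // leq_imset_card.
Qed.

Lemma card_matching_bound E M : balanced E M -> #|M| <= (N * m.*2.+1).+1.
Proof.
move=> bal; apply: leq_trans (card_matching bal) _; rewrite ltnS.
by apply: leq_trans (max_card _) _; rewrite card_prod !card_ord.
Qed.

Lemma card_restE E M : #|rest E M| =
  \sum_(i < N) #|[set p : 'I_m.*2.+1 | (pedge i p \in E) && (pedge i p \notin M)]|.
Proof.
rewrite card_imset ?(card_pairs (fun (i : 'I_N) (p : 'I_m.*2.+1) =>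
  (pedge i p \in E) && (pedge i p \notin M))) // => -[i p] [j q] /=.
by case/pedge_inj => // /val_inj -> /val_inj ->.
Qed.

Lemma quiet_rest_large E M : balanced E M -> quiet E M -> N <= #|rest E M|.
Proof.
move=> bal qu; rewrite card_restE -[X in X <= _]card_ord -sum1_card.
apply: leq_sum => i _; have [l _ [_]] := quiet_row i bal qu.
exact: leq_trans.
Qed.

(** Row by row, with x edges in M and y outside: (m+1)x <= (m+1)l <= m(l+1) <= my, using l <= m. The
    predecessor discards a possible star edge. *)
Lemma quiet_ratio E M : balanced E M -> quiet E M ->
  m.+1 * #|M|.-1 <= m * #|rest E M|.
Proof.
move=> bal qu; have := card_matching bal.
rewrite (card_pairs (fun (i : 'I_N) (p : 'I_m.*2.+1) => pedge i p \in M)) => cM.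
apply: (@leq_trans (m.+1 * \sum_(i < N) #|[set p : 'I_m.*2.+1 | pedge i p \in M]|)).
  by rewrite leq_mul2l; case: #|M| cM => //= n; rewrite ltnS => ->; rewrite orbT.
rewrite card_restE !big_distrr /=; apply: leq_sum => i _.
have [l lm [xl ly]] := quiet_row i bal qu.
apply: leq_trans (leq_mul (leqnn m.+1) xl) _.
by apply: leq_trans (leq_mul (leqnn m) ly); nia.
Qed.

(** * Plays *)

(* What the algorithm sees: the adversary's own matching does not appear. *)
Definition view := seq ({set 'I_nverts} * {set {set 'I_nverts}}).

Implicit Type w : view.

Definition edges w := [seq s.1 | s <- w].
Definition cur w : {set {set 'I_nverts}} := last set0 [seq s.2 | s <- w].
Definition play_edge w := next_edge (edges w) (cur w).
Definition quietv w := quiet (edges w) (cur w).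

Lemma edges_rcons w x : edges (rcons w x) = rcons (edges w) x.1.
Proof. exact: map_rcons. Qed.

Lemma cur_rcons w x : cur (rcons w x) = x.2.
Proof. by rewrite /cur map_rcons last_rcons. Qed.

(** Contains every view that occurs with positive probability within the T timesteps for which there
    are leaves. *)
Inductive run : view -> Prop :=
| run_nil : run [::]
| run_rcons w M : run w -> size w < T ->
    valid_update m.*2 [set x in rcons (edges w) (play_edge w)] (cur w) M ->
    run (rcons w (play_edge w, M)).

Lemma run_balanced w : run w -> size w <= T /\ balanced (edges w) (cur w).
Proof.
elim=> [|{}w M rw [_ bal] sw vu].
  split=> //; split=> [//||i iN]; last by left.
  by apply/andP; split; [exact: sub0set|apply/trivIsetP => A B; rewrite inE].
rewrite size_rcons edges_rcons cur_rcons; split=> //.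
by apply: balanced_update vu; apply: balanced_next; rewrite ?size_map.
Qed.

Lemma run_fresh w : run w -> size w < T ->
  is_edge (play_edge w) /\ play_edge w \notin edges w.
Proof.
move=> rw sw; have [_ [bE _ _]] := run_balanced rw.
by apply: next_edge_fresh; rewrite ?size_map.
Qed.

Lemma legal_from_rcons (k : nat) es (M0 : {set {set 'I_nverts}}) w e M :
  legal_from k es M0 (rcons w (e, M)) =
  legal_from k es M0 w && [&& is_edge e, e \notin es ++ edges w &
    valid_update k [set x in rcons (es ++ edges w) e] (last M0 [seq s.2 | s <- w]) M].
Proof.
elim: w es M0 => [|[e1 M1] w IHw] es M0 /=; first by rewrite cats0 andbT.
by rewrite IHw /= cat_rcons -!andbA.
Qed.

Lemma run_legal w : run w -> legal_hist m.*2 w.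
Proof.
elim=> [//|{}w M rw lw sw vu].
have [eP eN] := run_fresh rw sw.
by rewrite /legal_hist legal_from_rcons /= [legal_from _ _ _ _]lw eP eN.
Qed.

Lemma run_take t w : run w -> run (take t w).
Proof.
move=> rw; elim: rw t => [|{}w M rw IHw sw vu] t; first exact: run_nil.
case: (leqP t (size w)) => tw; first by rewrite takel_rcons.
by rewrite take_oversize ?size_rcons //; apply: run_rcons.
Qed.

Lemma run_take_succ t w : run w -> t < size w ->
  exists M, take t.+1 w = rcons (take t w) (play_edge (take t w), M).
Proof.
move=> rw; elim: rw t => [//|{}w M rw IHw sw vu] t.
rewrite size_rcons ltnS leq_eqVlt => /orP[/eqP->|tw].
  by exists M; rewrite (takel_rcons _ (leqnn _)) take_size take_oversize ?size_rcons.
have [M' eM] := IHw t tw; exists M'.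
by rewrite !takel_rcons // ltnW.
Qed.

Lemma run_card_cover w : run w -> #|cover (cur w)| = (#|cur w|).*2.
Proof.
move=> rw; have [sT [bE mM _]] := run_balanced rw.
case/andP: (mM) => _ /eqP <-.
rewrite -muln2 -sum_nat_const; apply: eq_bigr => e eM; apply/eqP.
case: (bE e (matches_sub mM eM)) => [[i [p [iN pK ->]]]|[t tE ->]].
  exact: is_edge_pedge.
by apply: is_edge_sedge; apply: leq_trans tE (geq_minr _ _).
Qed.

(** The covered set only grows, and it has twice as many elements as the matching. *)
Lemma run_card_mono t w : run w -> #|cur (take t w)| <= #|cur w|.
Proof.
move=> rw; rewrite -leq_double -(run_card_cover rw) -(run_card_cover (run_take t rw)).
apply: subset_leq_card.
elim: rw t => [|{}w M rw IHw sw vu] t //.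
case: (leqP t (size w)) => tw; last by rewrite take_oversize ?size_rcons.
rewrite takel_rcons // cur_rcons; apply: subset_trans (IHw t) _.
by case/and3P: vu.
Qed.

(** Every step from a non-quiet position reveals a new path edge. After N(2m+1) such steps all path
    edges are present and none is wanted. *)
Lemma quiet_soon t0 w : run w -> t0 + N * m.*2.+1 <= size w ->
  exists2 t, t0 <= t <= t0 + N * m.*2.+1 & quietv (take t w).
Proof.
move=> rw sw.
pose C t := [set q : 'I_N * 'I_m.*2.+1 | pedge q.1 q.2 \in edges (take t w)].
pose D := N * m.*2.+1.
case: (boolP (has (fun d => quietv (take (t0 + d) w)) (iota 0 D.+1))) => [/hasP[d]|/hasPn nq].
  by rewrite mem_iota => /andP[_ dD] qd; exists (t0 + d); rewrite // leq_addr leq_add2l.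
have cC d : d <= D -> d <= #|C (t0 + d)|.
  elim: d => // d IHd dD; apply: leq_ltn_trans (IHd (ltnW dD)) _.
  have lt : t0 + d < size w by apply: leq_trans sw; rewrite ltn_add2l.
  have [M eM] := run_take_succ rw lt.
  have := nq d; rewrite mem_iota /= add0n ltnS (ltnW dD) => /(_ isT).
  rewrite /C addnS eM edges_rcons /= /play_edge /next_edge.
  case: pickP => [q wq _|nw /forallP[] q]; last by rewrite nw.
  case/andP: (wq) => qE _.
  apply: proper_card; apply/properP; split.
    by apply/subsetP => r; rewrite !inE mem_rcons inE => ->; rewrite orbT.
  by exists q; rewrite !inE ?mem_rcons ?inE ?eqxx.
have full : C (t0 + D) = setT.
  by apply/eqP; rewrite eqEcard subsetT cardsT card_prod !card_ord cC.
have := nq D; rewrite mem_iota add0n ltnSn => /(_ isT)/negP[].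
apply/forallP => q; have := in_setT q; rewrite -full inE /wanted => qE.
by apply/negP => /andP[]; rewrite qE.
Qed.

(** * The matching built by the adversary *)

(* Equal to (size w).+1 if there is no such time; then [plan t0 w] is empty. *)
Definition start t0 w :=
  find (fun t => (t0 <= t) && quietv (take t w)) (iota 0 (size w).+1).

Definition target t0 w :=
  rest (edges (take (start t0 w) w)) (cur (take (start t0 w) w)).

(** One more edge of the target is taken per timestep after [start]. The truncated subtraction
    yields the empty matching before that. *)
Definition plan t0 w : {set {set 'I_nverts}} :=
  [set e in take (size w - start t0 w) (enum (target t0 w))].

Lemma startP t0 w : start t0 w <= size w -> t0 <= start t0 w /\ quietv (take (start t0 w) w).
Proof.
move=> sw; have hs : has (fun t => (t0 <= t) && quietv (take t w)) (iota 0 (size w).+1).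
  by rewrite has_find size_iota ltnS.
by have := nth_find 0 hs; rewrite -/(start t0 w) nth_iota ?ltnS // add0n => /andP[].
Qed.

Lemma start_le t0 w t : t0 <= t <= size w -> quietv (take t w) -> start t0 w <= t.
Proof.
move=> /andP[t0t tw] qt; rewrite leqNgt; apply/negP => lt.
by have := before_find 0 lt; rewrite nth_iota ?ltnS // add0n t0t qt.
Qed.

(** Once reached, the starting time is determined by the past, so the target stays fixed while it is
    being built. *)
Lemma start_rcons t0 w x : start t0 w <= size w -> start t0 (rcons w x) = start t0 w.
Proof.
move=> sw; rewrite /start size_rcons -[in LHS]addn1 iotaD find_cat.
have tk t : t \in iota 0 (size w).+1 -> take t (rcons w x) = take t w.
  by rewrite mem_iota => /andP[_ tw]; rewrite takel_rcons.
have eq_h : {in iota 0 (size w).+1, (fun t => (t0 <= t) && quietv (take t (rcons w x))) =1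
    (fun t => (t0 <= t) && quietv (take t w))} by move=> t /tk ->.
rewrite (eq_in_has eq_h) (eq_in_find eq_h) has_find size_iota ltnS.
by rewrite -/(start t0 w) sw.
Qed.

Lemma start_ge_rcons t0 w x : size w < start t0 w -> size w < start t0 (rcons w x).
Proof.
move=> sw; rewrite ltnNge; apply/negP => lt.
have lt' : start t0 (rcons w x) <= size (rcons w x) by rewrite size_rcons ltnW.
have [t0s] := startP lt'; rewrite takel_rcons // => qs.
have := start_le (t := start t0 (rcons w x)) (w := w) (t0 := t0).
by rewrite t0s lt => /(_ isT qs); lia.
Qed.

Lemma plan_early t0 w : size w <= start t0 w -> plan t0 w = set0.
Proof.
rewrite /plan => /eqP ->; rewrite take0.
by apply/setP => e; rewrite !inE.
Qed.

Lemma plan_sub t0 w : plan t0 w \subset target t0 w.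
Proof. by apply/subsetP => e; rewrite inE => /mem_take; rewrite mem_enum. Qed.

Lemma plan_matching t0 w : run w -> matches (edges w) (plan t0 w).
Proof.
move=> rw; case: (leqP (size w) (start t0 w)) => sw.
  rewrite plan_early //; apply/andP; split; first exact: sub0set.
  by apply/trivIsetP => A B; rewrite inE.
have [_ qs] := startP (ltnW sw).
have [_ bal] := run_balanced (run_take (start t0 w) rw).
apply/andP; split.
  apply/subsetP => e /(subsetP (plan_sub t0 w)) /rest_sub.
  by case/mapP => x /mem_take xw ->; rewrite inE map_f.
exact: trivIsetS (plan_sub t0 w) (quiet_rest_trivIset bal qs).
Qed.

(** The predicate marks the element that is added, if s is not yet exhausted. *)
Lemma take_succ_in (V : eqType) (s : seq V) d :
  exists a : V -> bool, (forall x y, a x -> a y -> x = y) /\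
    forall x, (x \in take d.+1 s) -> (x \in take d s) || a x.
Proof.
elim: s d => [|y s IHs] d; first by exists pred0.
case: d => [|d] /=.
  exists (pred1 y); split=> [x z /eqP-> /eqP-> //|x].
  by rewrite take0 inE.
have [a [a1 aP]] := IHs d; exists a; split=> // x.
by rewrite !inE => /orP[->//|/aP/orP[->|->]]; rewrite !orbT.
Qed.

(** No edge is removed and at most one is added, which affects at most 2 <= 2m vertices. *)
Lemma plan_update t0 w x : 0 < m -> run (rcons w x) ->
  valid_update m.*2 [set e in edges (rcons w x)] (plan t0 w) (plan t0 (rcons w x)).
Proof.
move=> m0 rwx; have mM := plan_matching t0 rwx.
have rw : run w.
  by have := run_take (size w) rwx; rewrite takel_rcons // take_size.
have [_ [bE _ _]] := run_balanced rwx.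
have [sub small] : plan t0 w \subset plan t0 (rcons w x) /\
    #|plan t0 (rcons w x) :\: plan t0 w| <= 1.
  case: (leqP (start t0 w) (size w)) => sw; last first.
    rewrite (plan_early (ltnW sw)) plan_early ?size_rcons ?start_ge_rcons //.
    by rewrite sub0set setDv cards0.
  rewrite /plan start_rcons // size_rcons subSn // /target start_rcons //.
  have -> : take (start t0 w) (rcons w x) = take (start t0 w) w.
    exact: takel_rcons.
  move: (size w - _) (enum _) => d s; split.
    apply/subsetP => e; rewrite !inE -(take_takel s (leqnSn d)); exact: mem_take.
  have [a [a1 aP]] := take_succ_in s d.
  apply/card_le1_eqP => e f; rewrite !inE => /andP[/negbTE ne /aP]; rewrite ne /= => ae.
  by move=> /andP[/negbTE nf /aP]; rewrite nf /= => af; apply: a1.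
apply/and3P; split=> //; last first.
  by apply/bigcupsP => e eA; apply: (bigcup_sup e) (subsetP sub e eA).
rewrite /reassignments; have -> : plan t0 w :\: plan t0 (rcons w x) = set0.
  by apply/eqP; rewrite setD_eq0.
rewrite set0U.
apply: leq_trans (_ : 2 <= _); last by lia.
apply: leq_trans (leq_card_cover _) _.
apply: (@leq_trans (\sum_(e in plan t0 (rcons w x) :\: plan t0 w) 2)).
  apply: leq_sum => e /setDP[eA _].
  have sz : size (edges (rcons w x)) <= T by have [] := run_balanced rwx; rewrite size_map.
  case: (bE e (matches_sub mM eA)) => [[i [p [iN pK ->]]]|[t tE ->]];
    by rewrite cards2; case: eqP.
by rewrite sum_nat_const; lia.
Qed.

(** N(2m+1) steps suffice to reach a quiet position and as many again to add all of [rest]. By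
    monotonicity the ratio at the quiet position bounds the algorithm's matching at the earlier time
    [t0]. *)
Lemma plan_final t0 w : run w -> t0 + (N * m.*2.+1).*2 <= size w ->
  N <= #|plan t0 w| /\ m.+1 * #|cur (take t0 w)|.-1 <= m * #|plan t0 w|.
Proof.
move=> rw sw; have [|t /andP[t0t tD] qt] := quiet_soon (t0 := t0) rw; first by lia.
have st : start t0 w <= t by apply: start_le => //; lia.
have sz : start t0 w <= size w by lia.
have [t0s qs] := startP sz.
have [_ bal] := run_balanced (run_take (start t0 w) rw).
have -> : plan t0 w = target t0 w.
  apply/setP => e; rewrite inE take_oversize ?mem_enum // -cardE.
  apply: leq_trans (card_rest _ _) _; lia.
split; first exact: quiet_rest_large.
apply: leq_trans (quiet_ratio bal qs); rewrite leq_mul2l /=.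
have := run_card_mono t0 (run_take (start t0 w) rw); rewrite take_takel //.
by rewrite -!subn1 => le; apply: leq_sub2r.
Qed.

End Gadgets.
(** * Expectations *)

Local Open Scope ring_scope.

Section Play.

Variables (R : realType) (N m T : nat) (alg : rand_alg R).
Hypothesis halg : valid_alg m.*2 alg.

Notation view := (view N m T).

Implicit Types (w : view) (g : view -> R).

(** Expectation over the algorithm's choices along views alone; it involves neither [t0] nor the
    adversary's matching, which allows different blocks to be compared. *)
Fixpoint vexp (F : nat) g w : R :=
  if F is F'.+1 then
    \sum_(M : {set {set 'I_(nverts N m T)}})
       alg w (play_edge w) M * vexp F' g (rcons w (play_edge w, M))
  else g w.

Lemma alg_step w : run w -> (size w < T)%N ->
  [/\ forall M, 0 <= alg w (play_edge w) M,
      \sum_M alg w (play_edge w) M = 1 &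
      forall M, 0 < alg w (play_edge w) M -> run (rcons w (play_edge w, M))].
Proof.
move=> rw sw; have [eP eN] := run_fresh rw sw.
have [ge0 sum1 pos] := halg (run_legal rw) eP eN.
by split=> // M /pos vu; apply: run_rcons.
Qed.

Lemma alg_sum_congr w (f f' : {set {set 'I_(nverts N m T)}} -> R) :
  run w -> (size w < T)%N ->
  (forall M, run (rcons w (play_edge w, M)) -> f M = f' M) ->
  \sum_M alg w (play_edge w) M * f M = \sum_M alg w (play_edge w) M * f' M.
Proof.
move=> rw sw eqf; have [ge0 _ pos] := alg_step rw sw.
apply: eq_bigr => M _; have := ge0 M; rewrite le_eqVlt => /orP[/eqP<-|/pos/eqf-> //].
by rewrite !mul0r.
Qed.

Lemma vexp_le F g g' w : run w -> (size w + F <= T)%N ->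
  (forall v, run v -> size v = (size w + F)%N -> g v <= g' v) ->
  vexp F g w <= vexp F g' w.
Proof.
elim: F w => [|F IHF] w rw sw le /=; first by apply: le; rewrite // addn0.
have [|ge0 _ pos] := alg_step rw; first by lia.
apply: ler_sum => M _; have := ge0 M; rewrite le_eqVlt => /orP[/eqP<-|pM].
  by rewrite !mul0r.
rewrite ler_wpM2l // IHF ?size_rcons ?addSnnS //; exact: pos.
Qed.

Lemma vexp_affine F g b d w : run w -> (size w + F <= T)%N ->
  vexp F (fun v => b * g v + d) w = b * vexp F g w + d.
Proof.
elim: F w => [//|F IHF] w rw sw /=.
have sT : (size w < T)%N by lia.
have [_ sum1 _] := alg_step rw sT.
rewrite (alg_sum_congr (f' := fun M => b * vexp F g (rcons w (play_edge w, M)) + d)) //.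
  rewrite -[X in _ = _ + X]mul1r -sum1 mulr_suml mulr_sumr -big_split /=.
  by apply: eq_bigr => M _; rewrite mulrDr mulrCA.
by move=> M rM; rewrite IHF // size_rcons addSnnS.
Qed.

Lemma vexp_const F d w : run w -> (size w + F <= T)%N -> vexp F (fun=> d) w = d.
Proof.
move=> rw sw; rewrite -[RHS]add0r -[X in X + d](mul0r (vexp F (fun=> 0) w)).
by rewrite -vexp_affine // mul0r add0r.
Qed.

Lemma vexp_take F g t w : run w -> (size w + F <= T)%N -> (t <= size w)%N ->
  vexp F (fun v => g (take t v)) w = g (take t w).
Proof.
elim: F w => [//|F IHF] w rw sw tw /=.
have sT : (size w < T)%N by lia.
have [_ sum1 _] := alg_step rw sT.
rewrite (alg_sum_congr (f' := fun=> g (take t w))) //.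
  by rewrite -big_distrl /= sum1 mul1r.
move=> M rM; rewrite IHF ?size_rcons ?addSnnS //; first by rewrite takel_rcons.
by rewrite leqW.
Qed.

(** The later steps have total probability 1 and integrate out. *)
Lemma vexp_prefix F F' g w : run w -> (size w + (F + F') <= T)%N ->
  vexp (F + F') (fun v => g (take (size w + F) v)) w = vexp F g w.
Proof.
elim: F w => [|F IHF] w rw sw.
  by rewrite add0n addn0 vexp_take ?take_size //=; lia.
have sT : (size w < T)%N by lia.
rewrite addSn /=; apply: alg_sum_congr => // M rM.
by have := IHF _ rM; rewrite !size_rcons !addSn !addnS; apply; lia.
Qed.

(** * The adversary and its expected values *)

Section Adversary.

Variables (t0 t1 : nat).
Hypotheses (m_gt0 : (0 < m)%N) (t1T : (t1 <= T)%N).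

Implicit Type h : seq (step (nverts N m T)).

Definition adv_ok h (e : {set 'I_(nverts N m T)}) A :=
  [&& is_edge e, e \notin [seq s.1.1 | s <- h] &
      valid_update m.*2 [set x in rcons [seq s.1.1 | s <- h] e]
                   (last set0 [seq s.1.2 | s <- h]) A].

(** The plan is taken on the view before the new edge, since the adversary moves before the
    algorithm answers; its matching thus lags one step behind. Testing [adv_ok] gives validity on
    arbitrary histories, and by [adv_ok_plan] the test succeeds on runs. *)
Definition stop_adv : adversary (nverts N m T) := fun h =>
  let w := alg_view h in
  if (size h < t1)%N && adv_ok h (play_edge w) (plan t0 w)
  then Some (play_edge w, plan t0 w) else None.

Lemma valid_stop_adv : valid_adv m.*2 stop_adv.
Proof. by move=> h _ _; rewrite /stop_adv; case: ifP => // /andP[]. Qed.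

Lemma adv_ok_plan h : run (alg_view h) -> (size h < T)%N ->
  last set0 [seq s.1.2 | s <- h] = plan t0 (take (size h).-1 (alg_view h)) ->
  adv_ok h (play_edge (alg_view h)) (plan t0 (alg_view h)).
Proof.
move=> rh sh eA; rewrite /adv_ok {}eA.
have -> : [seq s.1.1 | s <- h] = edges (alg_view h) by rewrite /edges -map_comp.
have szh : size (alg_view h) = size h by rewrite size_map.
have sT : (size (alg_view h) < T)%N by rewrite szh.
have [-> ->] := run_fresh rh sT; rewrite /= -szh.
have := matches_rcons (play_edge (alg_view h)) (plan_matching t0 rh).
rewrite /matches; case/lastP: (alg_view h) rh => [|w x] rw mM.
  by rewrite /valid_update [is_matching _ _]mM /= /reassignments setDv set0U
    /cover big_set0 cards0 leq0n subxx.
rewrite size_rcons /= takel_rcons // take_size.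
have /and3P[_ re cM] := plan_update t0 m_gt0 rw.
by apply/and3P; split.
Qed.

(** The play lasts exactly until time [t1], that is d more steps, whatever the fuel F >= d. *)
Lemma exp_val_stop_adv f g F d h : run (alg_view h) ->
  (size h + d)%N = t1 -> (d <= F)%N ->
  last set0 [seq s.1.2 | s <- h] = plan t0 (take (size h).-1 (alg_view h)) ->
  (forall h', run (alg_view h') ->
     last set0 [seq s.1.2 | s <- h'] = plan t0 (take (size h').-1 (alg_view h')) ->
     f h' = g (alg_view h')) ->
  exp_val alg stop_adv f F h = vexp d g (alg_view h).
Proof.
elim: F d h => [|F IHF] [|d] h rh sh dF eA fg //; first exact: fg.
  by rewrite /= {1}/stop_adv -sh addn0 ltnn /= fg.
have sT : (size h < T)%N by lia.
rewrite /= {1}/stop_adv adv_ok_plan // (_ : (size h < t1)%N = true) /=; last by lia.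
have vr M : alg_view (rcons h (play_edge (alg_view h), plan t0 (alg_view h), M)) =
    rcons (alg_view h) (play_edge (alg_view h), M) by rewrite /alg_view map_rcons.
apply: alg_sum_congr; rewrite ?size_map // => M rM.
rewrite (IHF d) ?vr //; first by rewrite size_rcons; lia.
by rewrite map_rcons last_rcons size_rcons /= takel_rcons ?size_map // take_oversize ?size_map.
Qed.

Lemma stop_adv_fuel : (t1 <= 'C(nverts N m T, 2))%N.
Proof.
apply: (leq_trans t1T); rewrite /nverts binS bin1.
by rewrite addnA leq_addl.
Qed.

Lemma E_ALG_stop_adv : E_ALG alg stop_adv = vexp t1 (fun w => #|cur w|%:R) [::].
Proof.
apply: exp_val_stop_adv; rewrite ?stop_adv_fuel //; first exact: run_nil.
  by rewrite /= plan_early.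
by move=> h _ _; rewrite /final_alg /cur -map_comp.
Qed.

Lemma E_ADV_stop_adv : E_ADV alg stop_adv =
  vexp t1 (fun w => #|plan t0 (take (size w).-1 w)|%:R) [::].
Proof.
apply: exp_val_stop_adv; rewrite ?stop_adv_fuel //; first exact: run_nil.
  by rewrite /= plan_early.
by move=> h _ eA; rewrite /final_adv eA size_map.
Qed.

End Adversary.

(** * Blocks of time *)

Notation block := (N * m.*2.+1).*2.+1.
Notation mean_size t := (vexp t (fun w => #|cur w|%:R) [::]).

Lemma mean_size_bound t : (t <= T)%N -> mean_size t <= (N * m.*2.+1).+1%:R.
Proof.
move=> tT; rewrite -[leRHS](@vexp_const t _ [::]) //; last exact: run_nil.
apply: vexp_le => // [|w rw _]; first exact: run_nil.
by have [_ /card_matching_bound bal] := run_balanced rw; rewrite ler_nat.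
Qed.

(** A block consists of the two phases of [plan_final] and one step for the lag of the adversary's
    matching. The summand 1 pays for a star edge. *)
Lemma plan_mean t0 (X := vexp (t0 + block) (fun w => #|plan t0 (take (size w).-1 w)|%:R) [::]) :
  (t0 + block <= T)%N ->
  N%:R <= X /\ mean_size t0 <= m%:R / m.+1%:R * X + 1.
Proof.
move=> tT; have r0 := run_nil N m T.
have fin w : run w -> size w = (t0 + block)%N ->
    (N <= #|plan t0 (take (size w).-1 w)|)%N /\
    (m.+1 * #|cur (take t0 w)|.-1 <= m * #|plan t0 (take (size w).-1 w)|)%N.
  move=> rw sw; rewrite -(@take_takel _ t0 (size w).-1) ?sw; last by lia.
  by apply: plan_final; [exact: run_take|rewrite size_takel ?sw; lia].
split.
  rewrite -(@vexp_const (t0 + block) N%:R [::]) //.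
  by apply: vexp_le => // w rw sw; rewrite ler_nat; case: (fin w rw sw).
(* The mean at time [t0] is rewritten over plays of full length, so that both sizes can be compared
   play by play. *)
rewrite -vexp_affine // -(@vexp_prefix t0 block) //.
apply: vexp_le => // w rw sw; have [_] := fin w rw sw.
rewrite -(ler_nat R) !natrM => le.
have m1 : 0 < m.+1%:R :> R by rewrite ltr0n.
rewrite -lerBlDr mulrAC ler_pdivlMr // mulrC.
apply: le_trans le; rewrite ler_wpM2l ?ler0n // lerBlDr natr1 ler_nat add0n.
exact: leqSpred.
Qed.

(** Otherwise each of the L blocks contributes more than delta, and the total exceeds the bound of
    [mean_size_bound]. *)
Lemma slow_block L (delta : R) : (L * block <= T)%N -> 0 < delta ->
  (N * m.*2.+1).+1%:R <= L%:R * delta ->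
  exists2 l, (l < L)%N & mean_size (l.+1 * block) <= mean_size (l * block) + delta.
Proof.
move=> LT d0 Ld.
case: (boolP [exists l : 'I_L, mean_size (l.+1 * block) <= mean_size (l * block) + delta]).
  by case/existsP => l le; exists l.
move/existsPn => fast.
have grow j : (0 < j <= L)%N -> j%:R * delta < mean_size (j * block).
  elim: j => // j IHj /= jL; have /= := fast (Ordinal jL); rewrite -ltNge; apply: le_lt_trans.
  rewrite -natr1 mulrDl mul1r lerD2r; case: (posnP j) => [->|j0].
    by rewrite mul0r mul0n /= ler0n.
  by rewrite ltW // IHj // j0 ltnW.
have L0 : (0 < L)%N.
  by case: L Ld {LT fast grow} => //; rewrite mul0r lern0.
have gL : L%:R * delta < mean_size (L * block) by rewrite grow // L0 leqnn.
by have := lt_le_trans gL (le_trans (mean_size_bound LT) Ld); rewrite ltxx.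
Qed.

End Play.

Theorem theorem8 (R : realType) (k : nat) (hk : (2 <= k)%N) (hkeven : ~~ odd k)
  (eps : R) (heps : 0 < eps) (alg : rand_alg R) (halg : valid_alg k alg)
  (c : R) (hc : 0 <= c) :
  exists (n : nat) (adv : adversary n),
    valid_adv k adv /\
    E_ALG alg adv < (1 - 2 / (k%:R + 2) + eps) * E_ADV alg adv - c.
Proof.
have [m m0 ek] : exists2 m, (0 < m)%N & k = m.*2.
  by exists k./2; [lia|rewrite -[LHS]odd_double_half (negbTE hkeven)].
rewrite {}ek in halg * => {k hk hkeven}.
(* N is such that N eps/2 exceeds the star edge plus c; L is such that some block has mean growth at
   most delta = N eps/2. *)
pose N := (Num.truncn (2 * (1 + c) / eps)).+1.
pose L := (Num.truncn (4 * m.+1%:R / eps)).+1.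
have e2 : 0 < eps / 2 by rewrite divr_gt0.
have NP : 1 + c < N%:R * (eps / 2).
  rewrite -ltr_pdivrMr // invf_div mulrA [X in X / _ < _]mulrC; exact: truncnS_gt.
have LP : 2 * m.+1%:R <= L%:R * (eps / 2).
  rewrite -ler_pdivrMr // invf_div mulrA ltW //.
  rewrite (_ : 2 * m.+1%:R * 2 = 4 * m.+1%:R); last by ring.
  exact: truncnS_gt.
pose B := (N * m.*2.+1).*2.+1; pose T := (L * B)%N.
have bound : (N * m.*2.+1).+1%:R <= L%:R * (N%:R * (eps / 2)).
  rewrite mulrCA; apply: (@le_trans _ _ (N%:R * (2 * m.+1%:R))).
    by rewrite -!natrM ler_nat; nia.
  by rewrite ler_wpM2l ?ler0n.
have [|l lL slow] := @slow_block R N m T alg halg L _ (leqnn _) _ bound.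
  by rewrite mulr_gt0 // ltr0n.
have t1T : (l * B + B <= T)%N by rewrite addnC -mulSn leq_mul2r lL orbT.
have [XN aX] := plan_mean halg t1T.
exists (nverts N m T), (@stop_adv N m T (l * B) (l * B + B)).
split; first exact: valid_stop_adv.
rewrite E_ALG_stop_adv // E_ADV_stop_adv //.
rewrite mulSn addnC in slow.
move: XN aX slow; set X := vexp _ _ _ [::]; set a := vexp _ _ _ [::].
move=> XN aX slow.
have -> : 1 - 2 / (m.*2%:R + 2) = m%:R / m.+1%:R :> R.
  have mR : 0 <= m%:R :> R by [].
  rewrite -muln2 natrM -natr1; field.
  by apply/andP; split; apply: lt0r_neq0; lra.
have : eps * N%:R <= eps * X by rewrite ler_wpM2l // ltW.
set r := _ / _ in aX *; rewrite mulrDl => XE.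
(* With r = m/(m+1): a + N eps/2 <= rX + 1 + N eps/2 < rX + N eps - c <= (r + eps)X - c. *)
by apply: le_lt_trans slow _; lra.
Qed.
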